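(* Let $n\ge 3$ and equip $\mathsf{SL}(n)$ with the HS metric. Then there exist a sequence of points $A_i\in \mathsf{SL}(n)$ and a sequence of nonparallel tangent vectors $X_i,Y_i\in T_{A_i}\mathsf{SL}(n)$ such that \[ \liminf_{i\to\infty} \frac{|K(X_i,Y_i;A_i)|}{|A_i^{-1}|^2} > 0,\] where $K(X,Y;A)$ denotes the sectional curvature at $A$ of the plane spanned by $X,Y\in T_A\mathsf{SL}(n)$.
   Context: $\mathcal{M}(n)$ is the space of real $n\times n$ matrices with the Hilbert-Schmidt inner product $\langle A,B\rangle=\operatorname{tr}(AB^T)$ and norm $|A|=\sqrt{\langle A,A\rangle}$. The HS metric on $\mathsf{SL}(n)=\{A\in\mathcal{M}(n):\det A=1\}$ is the Riemannian metric induced on it as a submanifold of the Euclidean space $\mathcal{M}(n)$. Tangent vectors $X\in T_A\mathsf{SL}(n)$ are regarded as matrices in $\mathcal{M}(n)$ (those with $\operatorname{tr}(A^{-1}X)=0$). The sectional curvature has the explicit form \[K(X,Y;A)=\frac{1}{|A^{-1}|^2}\,\frac{\operatorname{tr}(A^{-1}XA^{-1}X)\operatorname{tr}(A^{-1}YA^{-1}Y)-[\operatorname{tr}(A^{-1}XA^{-1}Y)]^2}{|X|^2|Y|^2-\langle X,Y\rangle^2}.\] *)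

(* Defs.v *)
From HB Require Import structures.
From mathcomp Require Import all_boot all_order all_algebra.
From mathcomp Require Import all_classical all_reals all_analysis.
From mathcomp Require Import perm ring.

Set Implicit Arguments.
Unset Strict Implicit.
Unset Printing Implicit Defensive.

Import Order.TTheory GRing.Theory Num.Theory.
Import numFieldNormedType.Exports.

Local Open Scope classical_set_scope.
Local Open Scope ring_scope.

Section HilbertSchmidt.
Variables (R : realType) (n : nat).
Implicit Types A B X Y : 'M[R]_n.

Definition HSdot A B : R := \tr (A *m B^T).

(* Not to be confused with the library's `|A|, which is the max norm; both
   norms induce the same topology, so derivatives below are unambiguous. *)
Definition HSnorm A : R := Num.sqrt (HSdot A A).

Definition SL : set 'M[R]_n := [set A | \det A = 1].

Definition tangentSL A : set 'M[R]_n := [set X | \tr (invmx A *m X) = 0].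

(* Since tr (A^-1 X) = <X, A^-T>, the matrix A^-T spans the normal line of
   SL(n) at A. *)
Definition normalSL A : 'M[R]_n := (invmx A)^T.

(* Orthogonal projection onto the tangent space at A; it makes sense at every
   invertible A, where it projects onto the tangent space of the level set of
   the determinant through A. *)
Definition projSL A X : 'M[R]_n :=
  X - (HSdot X (normalSL A) / HSdot (normalSL A) (normalSL A)) *: normalSL A.

Definition vfield := 'M[R]_n -> 'M[R]_n.

(* The Levi-Civita connection of the metric induced by the Euclidean space
   'M_n is the tangential part of the ambient directional derivative. *)
Definition nablaSL (V W : vfield) : vfield :=
  fun A => projSL A ('D_(V A) W A).

Definition lie_bracket (V W : vfield) : vfield :=
  fun A => 'D_(V A) W A - 'D_(W A) V A.

Definition riemannSL (V W Z : vfield) : vfield := fun A =>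
  nablaSL V (nablaSL W Z) A - nablaSL W (nablaSL V Z) A
  - nablaSL (lie_bracket V W) Z A.

(* A tangent field whose value at A is X whenever X is tangent at A. *)
Definition tangent_field X : vfield := fun B => projSL B X.

(* Sectional curvature <R(X,Y)Y, X> / (|X|^2 |Y|^2 - <X,Y>^2). The curvature
   tensor does not depend on the tangent fields extending X and Y. *)
Definition sectional_curvature X Y A : R :=
  let V := tangent_field X in
  let W := tangent_field Y in
  HSdot (riemannSL V W W A) X
  / (HSnorm X ^+ 2 * HSnorm Y ^+ 2 - HSdot X Y ^+ 2).

End HilbertSchmidt.

Section MatrixCalculus.
Variables (R : realType) (V : normedModType R).

Lemma is_derive_mxP m n (f : V -> 'M[R]_(m, n)) x v (d : 'M[R]_(m, n)) :
  is_derive x v f d <-> forall i j, is_derive x v (fun y => f y i j) (d i j).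
Proof.
split=> [[fx <-] i j|H].
  rewrite derive_mx// mxE; apply: derivableP.
  by move/derivable_mxP : fx; exact.
have fx : derivable f x v by apply/derivable_mxP => i j; case: (H i j).
apply: DeriveDef => //; rewrite derive_mx//.
by apply/matrixP => i j; rewrite mxE; case: (H i j).
Qed.

Lemma is_derive_bigsum (I : Type) (r : seq I) (f : I -> V -> R) (d : I -> R) x v :
  (forall i, is_derive x v (f i) (d i)) ->
  is_derive x v (fun y => \sum_(i <- r) f i y) (\sum_(i <- r) d i).
Proof.
move=> H; elim: r => [|a r IH].
  rewrite big_nil; under eq_fun do rewrite big_nil; exact: is_derive_cst.
rewrite big_cons; under eq_fun do rewrite big_cons.
exact: is_deriveD.
Qed.

Lemma derivable_bigprod (I : Type) (r : seq I) (f : I -> V -> R) x v :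
  (forall i, derivable (f i) x v) ->
  derivable (fun y => \prod_(i <- r) f i y) x v.
Proof.
move=> H; elim: r => [|a r IH].
  under eq_fun do rewrite big_nil; exact: derivable_cst.
under eq_fun do rewrite big_cons.
exact: derivableM.
Qed.

Lemma is_derive_mulmx m n p (f : V -> 'M[R]_(m, n)) (g : V -> 'M[R]_(n, p))
    x v df dg :
  is_derive x v f df -> is_derive x v g dg ->
  is_derive x v (fun y => f y *m g y) (df *m g x + f x *m dg).
Proof.
move=> /is_derive_mxP Hf /is_derive_mxP Hg; apply/is_derive_mxP => i j.
rewrite !mxE -big_split/=; under eq_fun do rewrite mxE.
apply: is_derive_bigsum => k.
refine (is_derive_eq (is_deriveM (Hf i k) (Hg k j)) _).
by rewrite /GRing.scale/= addrC [_ * df _ _]mulrC.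
Qed.

Lemma is_derive_trmx m n (f : V -> 'M[R]_(m, n)) x v df :
  is_derive x v f df -> is_derive x v (fun y => (f y)^T) df^T.
Proof.
move=> /is_derive_mxP Hf; apply/is_derive_mxP => i j.
by rewrite mxE; under eq_fun do rewrite mxE.
Qed.

Lemma is_derive_scalemx m n (c : V -> R) (f : V -> 'M[R]_(m, n)) x v dc df :
  is_derive x v c dc -> is_derive x v f df ->
  is_derive x v (fun y => c y *: f y) (dc *: f x + c x *: df).
Proof.
move=> Hc /is_derive_mxP Hf; apply/is_derive_mxP => i j.
rewrite !mxE; under eq_fun do rewrite mxE.
refine (is_derive_eq (is_deriveM Hc (Hf i j)) _).
by rewrite /GRing.scale/= addrC [_ * dc]mulrC.
Qed.

Lemma is_derive_HSdot n (f g : V -> 'M[R]_n) x v df dg :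
  is_derive x v f df -> is_derive x v g dg ->
  is_derive x v (fun y => HSdot (f y) (g y)) (HSdot df (g x) + HSdot (f x) dg).
Proof.
move=> Hf Hg.
have /is_derive_mxP H := is_derive_mulmx Hf (is_derive_trmx Hg).
rewrite /HSdot -linearD.
by apply: is_derive_bigsum => i; exact: H.
Qed.

Lemma derivable_det n (f : V -> 'M[R]_n) x v :
  derivable f x v -> derivable (fun y => \det (f y)) x v.
Proof.
move=> /derivable_mxP Hf; rewrite /determinant.
have := @is_derive_bigsum _ (index_enum {perm 'I_n}) (fun (s : 'S_n) y =>
  (-1) ^+ s * \prod_i f y i (s i)) (fun s => 'D_v (fun y =>
  (-1) ^+ s * \prod_i f y i (s i)) x) x v.
case=> // s; apply: derivableP; apply: derivableM; first exact: derivable_cst.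
exact: derivable_bigprod.
Qed.

Lemma derivable_adj n (f : V -> 'M[R]_n) x v :
  derivable f x v -> derivable (fun y => \adj (f y)) x v.
Proof.
move=> Hf; apply/derivable_mxP => i j.
under eq_fun do rewrite mxE /cofactor.
apply: derivableM; first exact: derivable_cst.
apply: derivable_det; apply/derivable_mxP => k l.
under eq_fun do rewrite !mxE.
by move/derivable_mxP : Hf; exact.
Qed.

End MatrixCalculus.

Section SLcurvature.
Variables (R : realType) (n : nat).
Implicit Types A B X Y Z : 'M[R]_n.

Lemma continuous_det : continuous (fun A => \det A).
Proof.
rewrite /determinant.
refine (@continuous_big R^o _ _ _ _ (@add_continuous R^o) _ _ _ _) => s _ B.
have h : continuous (fun A : 'M[R]_n => \prod_i A i (s i)).
  refine (@continuous_big R^o _ _ _ _ (@mul_continuous R) _ _ _ _) => i _ C.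
  exact: coord_continuous.
exact: (cvgM (cvg_cst _) (h B)).
Qed.

Lemma near_unitmx A : A \in unitmx -> \near A, A \in unitmx.
Proof.
rewrite unitmxE unitfE => dA.
have nd : nbhs (\det A) [set x : R | x != 0].
  by have := @open_neq R 0; rewrite openE => /(_ (\det A) dA).
near=> B; rewrite unitmxE unitfE; near: B; exact: (@continuous_det A _ nd).
Unshelve. all: by end_near.
Qed.

Lemma is_derive_invmx A v : A \in unitmx ->
  is_derive A v invmx (- (invmx A *m v *m invmx A)).
Proof.
move=> uA.
have did := @is_derive_id _ ('M[R]_n) A v.
have dinv : derivable invmx A v.
  apply: (@near_eq_derivable _ _ _ (fun B => (\det B)^-1 *: \adj B)).
    apply: filterS (near_unitmx uA) => B uB.
    by rewrite /invmx uB.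
  have [] := is_derive_scalemx (derivableP (derivableV (_ : (\det A) != 0)
    (derivable_det (@derivable_id _ _ A v)))) (derivableP (derivable_adj
    (@derivable_id _ _ A v))) => //.
  by rewrite -unitfE -unitmxE.
apply: DeriveDef => //.
have h1 := is_derive_mulmx (derivableP dinv) did.
have h2 : is_derive A v (fun B => invmx B *m B) 0.
  refine (near_eq_is_derive _ (is_derive_cst (1%:M : 'M[R]_n) A v)).
  by near=> B; rewrite mulVmx//; near: B; exact: near_unitmx.
have := @derive_val _ _ _ _ _ _ _ h1.
rewrite (@derive_val _ _ _ _ _ _ _ h2) => /(congr1 (mulmxr (invmx A))).
rewrite /= mul0mx mulmxDl mulmxK// => /eqP; rewrite eq_sym addr_eq0 => /eqP ->//.
Unshelve. all: by end_near. Qed.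

Let N := @normalSL R n.

Lemma is_derive_normalSL A v : A \in unitmx ->
  is_derive A v (@normalSL R n) (- (N A *m v^T *m N A)).
Proof.
move=> uA; refine (is_derive_eq (is_derive_trmx (is_derive_invmx v uA)) _).
by rewrite linearN/= !trmx_mul mulmxA.
Qed.

Lemma HSdotC X Y : HSdot X Y = HSdot Y X.
Proof. by rewrite /HSdot -mxtrace_tr trmx_mul trmxK. Qed.

Lemma HSdotDl X Y Z : HSdot (X + Y) Z = HSdot X Z + HSdot Y Z.
Proof. by rewrite /HSdot mulmxDl linearD. Qed.

Lemma HSdotNl X Z : HSdot (- X) Z = - HSdot X Z.
Proof. by rewrite /HSdot mulNmx linearN. Qed.

Lemma HSdotZl a X Z : HSdot (a *: X) Z = a * HSdot X Z.
Proof. by rewrite /HSdot -scalemxAl linearZ. Qed.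

Lemma HSdotE X Y : HSdot X Y = \sum_i \sum_j X i j * Y i j.
Proof.
by apply: eq_bigr => i _; rewrite mxE; apply: eq_bigr => j _; rewrite mxE.
Qed.

Lemma HSdot_ge0 X : 0 <= HSdot X X.
Proof.
by rewrite HSdotE; apply: sumr_ge0 => i _; apply: sumr_ge0 => j _; exact: sqr_ge0.
Qed.

Lemma HSdot_eq0 X : (HSdot X X == 0) = (X == 0).
Proof.
apply/idP/eqP => [|->]; last by rewrite /HSdot mul0mx linear0.
rewrite HSdotE psumr_eq0 => [/allP H|i _]; last first.
  by apply: sumr_ge0 => j _; exact: sqr_ge0.
apply/matrixP => i j; have /= := H i (mem_index_enum _).
rewrite psumr_eq0 => [/allP/(_ j (mem_index_enum _))|k _]; last exact: sqr_ge0.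
by rewrite /= mulf_eq0 orbb mxE => /eqP.
Qed.

Lemma normal_neq0 A : A \in unitmx -> (0 < n)%N -> HSdot (N A) (N A) != 0.
Proof.
move=> uA n0; rewrite HSdot_eq0; apply/eqP => /(congr1 trmx).
rewrite trmxK trmx0 => iA0; have := mulVmx uA.
rewrite iA0 mul0mx => /matrixP/(_ (Ordinal n0) (Ordinal n0)).
by rewrite !mxE eqxx => /eqP; rewrite eq_sym oner_eq0.
Qed.

Let coef X B := HSdot X (N B) / HSdot (N B) (N B).

Lemma derivable_coef A X v : A \in unitmx -> (0 < n)%N ->
  derivable (coef X) A v.
Proof.
move=> uA n0; have dN := @is_derive_normalSL A v uA.
apply: derivableM.
  by case: (is_derive_HSdot (is_derive_cst X A v) dN).
apply: derivableV; first exact: normal_neq0.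
by case: (is_derive_HSdot dN dN).
Qed.

Lemma coef_tangent A X : tangentSL A X -> HSdot X (N A) = 0.
Proof. by rewrite /tangentSL/= /HSdot /N /normalSL trmxK mxtrace_mulC. Qed.

Lemma is_derive_coef A X v : A \in unitmx -> (0 < n)%N -> tangentSL A X ->
  is_derive A v (coef X)
    (- (HSdot X (N A *m v^T *m N A) / HSdot (N A) (N A))).
Proof.
move=> uA n0 tX; have dN := @is_derive_normalSL A v uA.
have d1 := is_derive_HSdot (is_derive_cst X A v) dN.
have d2 : derivable (fun B => (HSdot (N B) (N B))^-1) A v.
  apply: derivableV; first exact: normal_neq0.
  by case: (is_derive_HSdot dN dN).
refine (is_derive_eq (is_deriveM d1 (derivableP d2)) _).
rewrite (coef_tangent tX) scale0r add0r.
rewrite [HSdot 0 _]/HSdot mul0mx linear0 add0r.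
by rewrite HSdotC HSdotNl HSdotC -[_ *: _]/(_ * _) mulrN mulrC.
Qed.

Lemma projSL_lin A : linear (projSL A).
Proof.
move=> a X Y; rewrite /projSL HSdotDl HSdotZl mulrDl -mulrA scalerDl -scalerA.
by rewrite scalerBr opprD addrACA.
Qed.

Lemma projSLZ A a X : projSL A (a *: X) = a *: projSL A X.
Proof.
by rewrite /projSL HSdotZl -mulrA -scalerA scalerBr.
Qed.

Lemma projSLD A X Y : projSL A (X + Y) = projSL A X + projSL A Y.
Proof. by have := projSL_lin A 1 X Y; rewrite !scale1r. Qed.

Lemma projSLN A X : projSL A (- X) = - projSL A X.
Proof. by rewrite -scaleN1r projSLZ scaleN1r. Qed.

Lemma projSL_normal A : A \in unitmx -> (0 < n)%N -> projSL A (N A) = 0.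
Proof. by move=> uA n0; rewrite /projSL divff ?scale1r ?subrr// normal_neq0. Qed.

Lemma projSL_tangent A X : tangentSL A X -> projSL A X = X.
Proof.
by move=> tX; rewrite /projSL coef_tangent// mul0r scale0r subr0.
Qed.

Lemma HSdot_projSL A X Y : tangentSL A Y -> HSdot (projSL A X) Y = HSdot X Y.
Proof.
move=> tY; rewrite /projSL HSdotDl HSdotNl HSdotZl [HSdot (normalSL A) Y]HSdotC.
by rewrite (coef_tangent tY) mulr0 subr0.
Qed.

Lemma projSLK A X : A \in unitmx -> (0 < n)%N ->
  projSL A (projSL A X) = projSL A X.
Proof.
move=> uA n0; rewrite {2}/projSL projSLD projSLN projSLZ projSL_normal//.
by rewrite scaler0 subr0.
Qed.

Lemma is_derive_tangent_field A X v : A \in unitmx -> (0 < n)%N ->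
  is_derive A v (tangent_field X)
   (- ('D_v (coef X) A *: N A + coef X A *: - (N A *m v^T *m N A))).
Proof.
move=> uA n0.
have d := is_derive_scalemx (derivableP (@derivable_coef A X v uA n0))
  (@is_derive_normalSL A v uA).
refine (is_derive_eq (is_deriveB (is_derive_cst X A v) d) _).
by rewrite sub0r.
Qed.

Lemma nabla_tangent_field A (V : vfield R n) X : A \in unitmx -> (0 < n)%N ->
  nablaSL V (tangent_field X) A
  = coef X A *: projSL A (N A *m (V A)^T *m N A).
Proof.
move=> uA n0; rewrite /nablaSL.
rewrite (@derive_val _ _ _ _ _ _ _ (@is_derive_tangent_field A X (V A) uA n0)).
rewrite projSLN projSLD !projSLZ projSL_normal// projSLN scaler0 add0r.
by rewrite scalerN opprK.
Qed.

Lemma nabla_nabla A (V : vfield R n) X Y : A \in unitmx -> (0 < n)%N ->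
  tangentSL A X -> tangentSL A Y ->
  nablaSL V (nablaSL (tangent_field X) (tangent_field Y)) A
  = - (HSdot Y (N A *m (V A)^T *m N A) / HSdot (N A) (N A))
    *: projSL A (N A *m X^T *m N A).
Proof.
move=> uA n0 tX tY; rewrite {1}/nablaSL.
have -> : 'D_(V A) (nablaSL (tangent_field X) (tangent_field Y)) A =
    'D_(V A) (fun B => coef Y B *:
       projSL B (N B *m (projSL B X)^T *m N B)) A.
  apply: near_eq_derive; apply: filterS (near_unitmx uA) => B uB.
  by rewrite nabla_tangent_field.
set v := V A.
have dN := @is_derive_normalSL A v uA.
have [] : exists d, is_derive A v
    (fun B => projSL B (N B *m (projSL B X)^T *m N B)) d.
  have d1 := is_derive_mulmx (is_derive_mulmx dN (is_derive_trmx
      (@is_derive_tangent_field A X v uA n0))) dN.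
  have dq : derivable (fun B => (HSdot (N B) (N B))^-1) A v.
    apply: derivableV; first exact: normal_neq0.
    by case: (is_derive_HSdot dN dN).
  have d2 := is_deriveM (is_derive_HSdot d1 dN) (derivableP dq).
  eexists; exact: (is_deriveB d1 (is_derive_scalemx d2 dN)).
move=> d dd.
rewrite (@derive_val _ _ _ _ _ _ _ (is_derive_scalemx
  (@is_derive_coef A Y v uA n0 tY) dd)).
rewrite {1}/coef (coef_tangent tY) mul0r scale0r addr0 projSLZ projSLK//.
by rewrite (projSL_tangent tX).
Qed.

(* The intrinsic definition above agrees with the closed formula obtained from
   the Gauss equation. *)
Lemma sectional_curvatureE A X Y :
  SL A -> tangentSL A X -> tangentSL A Y ->
  sectional_curvature X Y A =
    (HSnorm (invmx A) ^+ 2)^-1 *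
    ((\tr (invmx A *m X *m invmx A *m X) * \tr (invmx A *m Y *m invmx A *m Y)
      - \tr (invmx A *m X *m invmx A *m Y) ^+ 2)
     / (HSnorm X ^+ 2 * HSnorm Y ^+ 2 - HSdot X Y ^+ 2)).
Proof.
move=> dA tX tY; rewrite /sectional_curvature [RHS]mulrA; congr (_ / _).
have [n0|] := ltnP 0 n; last first.
  rewrite leqn0 => /eqP n0; rewrite /HSdot /mxtrace.
  have o0 (i : 'I_n) : False by case: i => i; rewrite n0.
  rewrite !big1 => [|i|i|i|i]; try by have := o0 i.
  by rewrite mulr0 expr0n subrr mulr0.
have uA : A \in unitmx by rewrite unitmxE dA unitr1.
rewrite /riemannSL !nabla_nabla// nabla_tangent_field//.
rewrite {1}/coef (coef_tangent tY) mul0r scale0r subr0.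
rewrite /tangent_field (projSL_tangent tX) (projSL_tangent tY).
rewrite HSdotDl HSdotNl !HSdotZl !HSdot_projSL//.
have -> : HSnorm (invmx A) ^+ 2 = HSdot (N A) (N A).
  rewrite sqr_sqrtr ?HSdot_ge0// /N /normalSL /HSdot trmxK.
  by rewrite -mxtrace_tr trmx_mul trmxK mxtrace_mulC.
have E U W : HSdot U (N A *m W^T *m N A) =
    \tr (invmx A *m W *m invmx A *m U).
  rewrite /HSdot /N /normalSL !trmx_mul !trmxK.
  by rewrite mxtrace_mulC !mulmxA.
rewrite ![HSdot (_ *m _) X]HSdotC !E.
have -> : \tr (invmx A *m Y *m invmx A *m X) = \tr (invmx A *m X *m invmx A *m Y).
  by rewrite -mulmxA mxtrace_mulC mulmxA.
by field; rewrite normal_neq0.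
Qed.

End SLcurvature.

(* Main.v *)
(** On the plane spanned by [X = E_ij + E_ji] and [Y = E_ij - E_ji], at a point
    [A] with [A^-1 = diag a], the curvature formula gives
    [K = - (a_i a_j)^2 / |A^-1|^2].  For [n >= 3] the two entries [a_i] and
    [a_j] can both be equal to an arbitrarily large [t], the determinant being
    compensated by a third entry [t^-2].  Then [|A^-1|^2 <= n t^2], hence
    [|K| / |A^-1|^2 >= n^-2], along a family with [|A^-1|] unbounded. *)
Require Import Defs.
From mathcomp Require Import all_boot all_order all_algebra.
From mathcomp Require Import all_classical all_reals all_analysis.
From mathcomp Require Import ring lra.
Import Order.TTheory GRing.Theory Num.Theory.
Import numFieldNormedType.Exports.
Local Open Scope classical_set_scope.
Local Open Scope ring_scope.

(** A bound valid for every term passes to all tail infima, hence to their limit. No convergence of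
    [u] is involved. *)
Lemma limn_einf_ge (R : realType) (c : \bar R) (u : (\bar R)^nat) :
  (forall k, (c <= u k)%E) -> (c <= limn_einf u)%E.
Proof.
move=> cu; rewrite limn_einf_lim; apply: lime_ge; first exact: is_cvg_einfs.
by apply: nearW => k; apply: le_ereal_inf_tmp => _ [l _ <-].
Qed.

Section OffDiagonalPlane.
Set Implicit Arguments.
Unset Strict Implicit.
Variables (R : realType) (n : nat).
Implicit Types (a : 'rV[R]_n) (i j : 'I_n) (x y t : R).

(** This two-parameter family is stable under transposition and under left multiplication by
    diagonal matrices, so every trace in the curvature formula becomes the trace of a product of two
    of its members. *)
Definition antidiag i j x y : 'M[R]_n :=
  x *: delta_mx i j + y *: delta_mx j i.

Lemma diag_mul_antidiag a i j x y :
  diag_mx a *m antidiag i j x y = antidiag i j (a 0 i * x) (a 0 j * y).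
Proof.
have D k l : diag_mx a *m delta_mx k l = a 0 k *: delta_mx k l :> 'M[R]_n.
  apply/matrixP => p q; rewrite mul_diag_mx !mxE.
  by case: (eqVneq p k) => [->|] //=; rewrite !mulr0.
by rewrite mulmxDr -!scalemxAr !D !scalerA ![_ * a _ _]mulrC.
Qed.

Lemma trmx_antidiag i j x y : (antidiag i j x y)^T = antidiag i j y x.
Proof. by rewrite /antidiag linearD !linearZ /= !trmx_delta addrC. Qed.

Lemma mxtrace_delta i j : \tr (delta_mx i j : 'M[R]_n) = (i == j)%:R.
Proof.
rewrite /mxtrace (bigD1 i)//= mxE eqxx /= big1 ?addr0 // => k ki.
by rewrite mxE (negPf ki).
Qed.

Lemma mxtrace_antidiag i j x y : i != j -> \tr (antidiag i j x y) = 0.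
Proof.
move=> ij; rewrite linearD !linearZ /= !mxtrace_delta (eq_sym j) (negPf ij).
by rewrite !mulr0 addr0.
Qed.

Lemma mxtrace_mul_antidiag i j x y z w : i != j ->
  \tr (antidiag i j x y *m antidiag i j z w) = x * w + y * z.
Proof.
move=> ij; have ji : j != i by rewrite eq_sym.
rewrite /antidiag mulmxDl !mulmxDr -!scalemxAl -!scalemxAr.
rewrite !mul_delta_mx !mul_delta_mx_0 // !scaler0 add0r addr0.
by rewrite linearD !linearZ /= !mxtrace_delta !eqxx !mulr1.
Qed.

Lemma free_antidiag i j : i != j ->
  free [:: antidiag i j 1 1; antidiag i j 1 (- 1)].
Proof.
move=> ij; apply/(@freeP _ _ 2 [tuple _; _]) => k.
rewrite !big_ord_recl big_ord0 addr0 /= => /matrixP E.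
have := E i j; have := E j i; rewrite !mxE !eqxx eq_sym (negPf ij) /= => E1 E2 l.
(* The entries at [(i, j)] and [(j, i)] give the sum and the difference of the two coefficients. *)
have [k0 k1] : k ord0 = 0 /\ k (lift ord0 ord0) = 0 by split; lra.
case: l => [[|[|l]] hl] //; [rewrite -[RHS]k0|rewrite -[RHS]k1]; congr (k _);
  exact: val_inj.
Qed.

(** The point is written as an inverse so that [invmxK] turns its inverse into [diag_mx a]. Tangency
    then holds because [diag_mx a] times an antidiagonal matrix has zero diagonal. *)
Lemma sectional_curvature_antidiag a i j : i != j -> \prod_k a 0 k = 1 ->
  [/\ SL (invmx (diag_mx a)),
      tangentSL (invmx (diag_mx a)) (antidiag i j 1 1),
      tangentSL (invmx (diag_mx a)) (antidiag i j 1 (- 1)) &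
      sectional_curvature (antidiag i j 1 1) (antidiag i j 1 (- 1))
        (invmx (diag_mx a))
      = - ((a 0 i * a 0 j) ^+ 2 / HSnorm (diag_mx a) ^+ 2)].
Proof.
move=> ij a1.
have dA : SL (invmx (diag_mx a)) by rewrite /SL /= det_inv det_diag a1 invr1.
have tX x y : tangentSL (invmx (diag_mx a)) (antidiag i j x y).
  by rewrite /tangentSL /= invmxK diag_mul_antidiag mxtrace_antidiag.
split => //; rewrite sectional_curvatureE // invmxK.
(* Grouped as products of two factors, the traces for [(X, X)], [(Y, Y)] and [(X, Y)] are
   [2 a_i a_j], [- 2 a_i a_j] and [0]. As [X] and [Y] are orthogonal with square norm 2, the factors
   4 cancel. *)
rewrite -!(mulmxA (_ *m _)) !diag_mul_antidiag !mxtrace_mul_antidiag //.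
rewrite !sqr_sqrtr ?HSdot_ge0 // /HSdot !trmx_antidiag !mxtrace_mul_antidiag //.
by rewrite -[RHS]mulNr [RHS]mulrC; congr (_ * _); field.
Qed.

Lemma HSnorm_diag_sqr a : HSnorm (diag_mx a) ^+ 2 = \sum_k a 0 k ^+ 2.
Proof.
rewrite sqr_sqrtr ?HSdot_ge0 // /HSdot tr_diag_mx mulmx_diag mxtrace_diag.
by apply: eq_bigr => k _; rewrite mxE.
Qed.

Lemma HSnorm_diag_sqr_le a t : (forall k, 0 <= a 0 k <= t) ->
  HSnorm (diag_mx a) ^+ 2 <= n%:R * t ^+ 2.
Proof.
move=> at_; rewrite HSnorm_diag_sqr mulr_natl.
have -> : t ^+ 2 *+ n = \sum_(k < n) t ^+ 2 by rewrite sumr_const card_ord.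
apply: ler_sum => k _; case/andP: (at_ k) => a_ge0 a_le.
by rewrite lerXn2r ?nnegrE // (le_trans a_ge0).
Qed.

Lemma curvature_ratio_ge a i j t : i != j -> 0 < t ->
  (forall k, 0 <= a 0 k <= t) -> a 0 i = t -> a 0 j = t ->
  \prod_k a 0 k = 1 ->
  n%:R ^- 2 <=
  `|sectional_curvature (antidiag i j 1 1) (antidiag i j 1 (- 1))
      (invmx (diag_mx a))| / HSnorm (diag_mx a) ^+ 2.
Proof.
move=> ij t0 at_ ait ajt a1.
have [_ _ _ ->] := sectional_curvature_antidiag ij a1.
have N_le := HSnorm_diag_sqr_le at_.
have N_gt0 : 0 < HSnorm (diag_mx a) ^+ 2.
  rewrite HSnorm_diag_sqr (bigD1 i) //= ait ltr_pwDl ?exprn_gt0 //.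
  by apply: sumr_ge0 => k _; exact: sqr_ge0.
have n0 : 0 < n%:R :> R by rewrite ltr0n; exact: leq_ltn_trans (ltn_ord i).
rewrite normrN normrM normfV !ger0_norm ?sqr_ge0 ?(ltW N_gt0) // ait ajt.
set N := HSnorm _ ^+ 2 in N_le N_gt0 *.
(* With the numerator [t ^+ 4] on both sides, only the denominators remain to be compared, and this
   is the square of [N_le]. *)
have -> : n%:R ^- 2 = (t * t) ^+ 2 / (n%:R * t ^+ 2) ^+ 2.
  by field; rewrite !gt_eqF.
rewrite -[X in _ <= X]mulrA -invfM -(expr2 N) ler_wpM2l ?sqr_ge0 //.
have M_gt0 : 0 < n%:R * t ^+ 2 by rewrite mulr_gt0 ?exprn_gt0.
rewrite lef_pV2; last 2 first.
- by rewrite posrE exprn_gt0.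
- by rewrite posrE exprn_gt0.
by rewrite lerXn2r ?nnegrE ?(ltW N_gt0) ?(ltW M_gt0).
Qed.

End OffDiagonalPlane.

Theorem proposition2p25 (R : realType) (n : nat) (n_ge3 : (3 <= n)%N) :
  exists A X Y : nat -> 'M[R]_n,
    [/\ forall i, SL (A i),
        forall i, tangentSL (A i) (X i) /\ tangentSL (A i) (Y i),
        forall i, free [:: X i; Y i]
      & (0 < limn_einf (fun i =>
           (`|sectional_curvature (X i) (Y i) (A i)|
            / HSnorm (invmx (A i)) ^+ 2)%:E))%E].
Proof.
case: n n_ge3 => [|[|[|m]]] // _.
pose i0 : 'I_m.+3 := ord0; pose i1 : 'I_m.+3 := lift ord0 ord0.
(* Starting at 1 rather than 0 gives [t k ^- 2 <= 1 <= t k], so that [t k] bounds all the entries of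
   [a k]. *)
pose t (k : nat) : R := k.+1%:R.
pose a k : 'rV[R]_m.+3 :=
  \row_l (if (l < 2)%N then t k else if l == 2 :> nat then t k ^- 2 else 1).
have i01 : i0 != i1 by [].
have t1 k : 1 <= t k by rewrite ler1n.
have t0 k : 0 < t k := lt_le_trans ltr01 (t1 k).
have a1 k : \prod_l a k 0 l = 1.
  (* Three factors split off, [t * t * t ^- 2]; the remaining [m] factors are all 1. *)
  rewrite !big_ord_recl big1 => [|l _]; rewrite !mxE //=.
  by rewrite mulr1 mulrA -expr2 divff // expf_neq0 // gt_eqF.
have a_le k l : 0 <= a k 0 l <= t k.
  rewrite mxE; case: ifP => _; first by rewrite lexx ltW.
  case: ifP => _; last by rewrite ler01 t1.
  rewrite invr_ge0 exprn_ge0 ?(ltW (t0 k)) //=.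
  by rewrite (le_trans _ (t1 k)) // invf_le1 ?exprn_gt0 // exprn_ege1.
exists (fun k => invmx (diag_mx (a k))), (fun=> antidiag i0 i1 1 1),
  (fun=> antidiag i0 i1 1 (- 1)); split => [k|k|_|].
- by case: (sectional_curvature_antidiag i01 (a1 k)).
- by case: (sectional_curvature_antidiag i01 (a1 k)).
- exact: free_antidiag.
(* The bound [n ^- 2] does not depend on [k], so it survives in the liminf. *)
apply: (@lt_le_trans _ _ (m.+3%:R ^- 2)%:E).
  by rewrite lte_fin invr_gt0 exprn_gt0 ?ltr0n.
apply: limn_einf_ge => k; rewrite lee_fin invmxK.
by apply: (curvature_ratio_ge i01 (t0 k) (a_le k)); rewrite ?mxE.
Qed.
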